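(* Let $(r_n)_{n\in\mathbb{N}}$ and $(m_n)_{n\in\mathbb{N}}$ be two increasing sequences of positive integers, and let $A=(A_n)$ and $B=(B_n)$ with $A_n\subset\{0,1\}^{r_n}$ and $B_n\subset\{0,1\}^{m_n}$ be two non trivial monotone properties. Suppose that the threshold of $A$ is located at $1$ and that of $B$ is located at $0$: $$\forall\varepsilon\in\,]0,1[,\quad p_{A_n,\varepsilon}\xrightarrow[n\to+\infty]{}1,\qquad\text{and}\qquad \forall\varepsilon\in\,]0,1[,\quad p_{B_n,\varepsilon}\xrightarrow[n\to+\infty]{}0 .$$ Then the thresholds of $A\otimes B=(A_n\otimes B_n)$ and $B\otimes A=(B_n\otimes A_n)$ are sharp.
   Context: For $p\in[0,1]$, $\mu_{N,p}$ (also written $\mu_p$) is the product of $N$ Bernoulli measures of parameter $p$ on $\{0,1\}^N$. A subset $A\subset\{0,1\}^N$ is monotone if $x\in A$ and $x\preceq y$ imply $y\in A$, where $\preceq$ is the coordinatewise partial order; it is non trivial if $A\neq\emptyset$ and $A\ne\{0,1\}^N$. For non trivial monotone $A$ and $\alpha\in[0,1]$, $p_{A,\alpha}$ is the unique real in $[0,1]$ with $\mu_{p_{A,\alpha}}(A)=\alpha$, and $\tau(A,\varepsilon)=p_{A,1-\varepsilon}-p_{A,\varepsilon}$. A (non trivial monotone) property is a sequence of (non trivial monotone) subsets $A_n$ of hypercubes $\{0,1\}^{\alpha_n}$. Product: for $A\subset\{0,1\}^r$ and $B\subset\{0,1\}^m$, $A\otimes B\subset(\{0,1\}^r)^m\cong\{0,1\}^{rm}$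 is the set of $\eta=(\eta_1,\ldots,\eta_m)$, $\eta_j\in\{0,1\}^r$, such that $(\mathbf{1}_{\eta_1\in A},\ldots,\mathbf{1}_{\eta_m\in A})\in B$. Sharp threshold: a property $A=(A_n)$ has a sharp threshold if for every $\varepsilon\in\,]0,1[$, $$\frac{\tau(A_n,\varepsilon)}{p_{A_n,1/2}\,(1-p_{A_n,1/2})}\xrightarrow[n\to+\infty]{}0 .$$ *)

(* Defs.v *)
From mathcomp Require Import all_boot all_order all_algebra.
From mathcomp Require Import all_classical all_reals all_analysis.
Import Order.TTheory GRing.Theory Num.Theory numFieldNormedType.Exports.

Set Implicit Arguments.
Unset Strict Implicit.
Unset Printing Implicit Defensive.

Local Open Scope classical_set_scope.
Local Open Scope ring_scope.

Definition cube (N : nat) := {ffun 'I_N -> bool}.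

Definition cube_le (N : nat) (x y : cube N) : Prop := forall i, (x i <= y i)%N.

Definition monotone_subset (N : nat) (A : {set cube N}) : Prop :=
  forall x y : cube N, x \in A -> cube_le x y -> y \in A.

Definition nontrivial_subset (N : nat) (A : {set cube N}) : Prop :=
  A <> finset.set0 /\ A <> [set: cube N]%SET.

(* A subset [A n] of {0,1}^(N n) for each n, all non trivial and monotone. *)
Definition nontrivial_monotone_property (N : nat -> nat)
    (A : forall n, {set cube (N n)}) : Prop :=
  forall n, nontrivial_subset (A n) /\ monotone_subset (A n).

(* The product of N Bernoulli measures of parameter p, as a finite sum of
   point masses; [bernoulli_pmf p b] is p if b = true and 1 - p otherwise. *)
Definition mu (R : realType) (N : nat) (p : R) (A : {set cube N}) : R :=
  \sum_(x in A) \prod_(i < N) bernoulli_pmf p (x i).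

(* The p in [0, 1] with mu p A = alpha.  It exists and is unique when A is
   non trivial and monotone and alpha is in [0, 1]; the default value 0 is only
   relevant outside of this case. *)
Definition plevel (R : realType) (N : nat) (A : {set cube N}) (alpha : R) : R :=
  xget 0 [set p : R | 0 <= p <= 1 /\ mu p A = alpha].

Definition tau (R : realType) (N : nat) (A : {set cube N}) (eps : R) : R :=
  plevel A (1 - eps) - plevel A eps.

(* The j-th of the m blocks of length r of eta, where {0,1}^(m * r) is
   identified with ({0,1}^r)^m through the row-major bijection [mxvec_index]. *)
Definition block (m r : nat) (eta : cube (m * r)) (j : 'I_m) : cube r :=
  [ffun i : 'I_r => eta (mxvec_index j i)].

Definition otimes (r m : nat) (A : {set cube r}) (B : {set cube m}) :
    {set cube (m * r)} :=
  [set eta : cube (m * r) | [ffun j : 'I_m => block eta j \in A] \in B]%SET.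

Definition sharp_threshold (R : realType) (N : nat -> nat)
    (A : forall n, {set cube (N n)}) : Prop :=
  forall eps : R, 0 < eps < 1 ->
    tau (A n) eps / (plevel (A n) (1 / 2) * (1 - plevel (A n) (1 / 2)))
      @[n --> \oo] --> (0 : R).

(* Main.v *)
Require Import Defs.
From mathcomp Require Import all_boot all_order all_algebra.
From mathcomp Require Import all_classical all_reals all_analysis.
From mathcomp Require Import ring lra.
Import Order.TTheory GRing.Theory Num.Theory numFieldNormedType.Exports.

(** Write f(p) = mu_p(A) and g(p) = mu_p(B). The blocks of a mu_p-distributed
    configuration are independent, so mu_p(A (x) B) = g(f(p)) ([mu_otimes]):
    the level p_{A (x) B, alpha} is the f-preimage of the g-preimage of alpha,
    and everything reduces to a statement about compositions of the functions
    p |-> mu_p(A) of monotone sets.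

    The only inequality needed about such a function is
      f(p^t) <= f(p)^t   for t >= 1   ([mu_powR]),
    together with its image under the symmetry p |-> 1 - p. It is proved by
    induction on the dimension; the induction step is an instance of the
    convexity of x^t. In logarithmic form, with S = - ln p and T = - ln f(p), it
    says that T/S is a nondecreasing function of S.

    Fix eps <= 1/2 and let u <= v be the levels of B at eps and 1 - eps, and
    x <= z their preimages under f. The dual inequality for g bounds v/u by a
    constant C that depends on eps only ([level_growth]). Hence T varies by at
    most ln C between z and x, while T itself tends to infinity because v tends
    to 0. By monotonicity of T/S, S varies by at most d * S_z where
    d = ln C / T_z tends to 0. Since the threshold of A is at 1, the point w with
    f(w) = 1/2 tends to 1. Eventually z <= w, so S_z / T_z <= S_w / ln 2, and
    d * S_z <= s where s = ln C * S_w / ln 2 tends to 0 as well. As z - x is at most z * d * S_z and 1 - y is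
    at least comparable to min(1, S_z) for every y between x and z, the ratio
    (z - x) / (y (1 - y)) is bounded by 2 (d + s) ([ratio_bound]), which gives the
    sharp threshold of A (x) B.

    For B (x) A, conjugate by p |-> 1 - p: this exchanges thresholds at 0 and
    at 1, maps a composition to the composition of the conjugates, and leaves
    the ratio defining sharpness unchanged ([sharp_curves_dual]). *)

Set Implicit Arguments.
Unset Strict Implicit.
Unset Printing Implicit Defensive.

Local Open Scope classical_set_scope.
Local Open Scope ring_scope.

(** * Bernoulli product measures of monotone sets *)

Section CubeMeasure.
Context {R : realType}.
Implicit Types (p t : R) (N : nat).

Definition weight {N} p (x : cube N) : R := \prod_(i < N) bernoulli_pmf p (x i).

Lemma weight_ge0 {N} p (x : cube N) : 0 <= p <= 1 -> 0 <= weight p x.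
Proof. by move=> hp; apply: prodr_ge0 => i _; apply: bernoulli_pmf_ge0. Qed.

Lemma sum_bernoulli_pmf p : \sum_b bernoulli_pmf p b = 1 :> R.
Proof. by rewrite big_bool /bernoulli_pmf /=; ring. Qed.

Lemma mu_setT {N} p : mu p [set: cube N]%SET = 1.
Proof.
rewrite /mu (eq_bigl predT); last by move=> x; rewrite inE.
rewrite -(bigA_distr_bigA (fun _ : 'I_N => bernoulli_pmf p)).
by rewrite big1 // => i _; exact: sum_bernoulli_pmf.
Qed.

Lemma mu_ge0 {N} p (A : {set cube N}) : 0 <= p <= 1 -> 0 <= mu p A.
Proof. by move=> hp; apply: sumr_ge0 => x _; apply: weight_ge0. Qed.

Lemma mu_subset {N} p (A B : {set cube N}) :
  0 <= p <= 1 -> A \subset B -> mu p A <= mu p B.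
Proof.
move=> hp AB; rewrite /mu [leRHS](big_setID A) /= (finset.setIidPr AB) lerDl.
by apply: sumr_ge0 => x _; apply: weight_ge0.
Qed.

Lemma mu_setC {N} p (A : {set cube N}) : mu p (~: A)%SET = 1 - mu p A.
Proof.
rewrite -(@mu_setT N p) /mu [in RHS](big_setID A) /= finset.setTI.
by rewrite finset.setTD [X in X - _]addrC addrK.
Qed.

Lemma mu_continuous {N} (A : {set cube N}) : continuous (fun p : R => mu p A).
Proof.
pose P : {poly R} :=
  \sum_(x in A) \prod_(i < N) (if x i then 'X else 1 - 'X).
have -> : (fun p : R => mu p A) = horner P.
  apply/funext => p; rewrite horner_sum; apply: eq_bigr => x _.
  rewrite horner_prod; apply: eq_bigr => i _; rewrite /bernoulli_pmf.
  by case: (x i); rewrite !hornerE.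
exact: continuous_horner.
Qed.

Definition cube_cons {N} (b : bool) (x : cube N) : cube N.+1 :=
  [ffun i => if unlift ord0 i is Some j then x j else b].

Lemma cube_cons0 {N} b (x : cube N) : cube_cons b x ord0 = b.
Proof. by rewrite ffunE unlift_none. Qed.

Lemma cube_consS {N} b (x : cube N) j : cube_cons b x (lift ord0 j) = x j.
Proof. by rewrite ffunE liftK. Qed.

Definition cube_section {N} (A : {set cube N.+1}) (b : bool) : {set cube N} :=
  [set x | cube_cons b x \in A]%SET.

Lemma mu_cube_section {N} p (A : {set cube N.+1}) :
  mu p A = p * mu p (cube_section A true) + (1 - p) * mu p (cube_section A false).
Proof.
pose c (u : bool * cube N) : cube N.+1 := cube_cons u.1 u.2.
have cbij : bijective c.
  exists (fun x : cube N.+1 => (x ord0, [ffun j => x (lift ord0 j)])).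
    case=> b x; rewrite /c /= cube_cons0; congr pair.
    by apply/ffunP => j; rewrite ffunE cube_consS.
  move=> x; apply/ffunP => i; rewrite /c ffunE /=.
  by case: unliftP => [j ->|->] //; rewrite ffunE.
have E b : mu p (cube_section A b) =
    \sum_(x : cube N | cube_cons b x \in A) weight p x.
  by apply: eq_bigl => x; rewrite inE.
rewrite {1}/mu (reindex c) /=; last exact: onW_bij.
rewrite -(pair_big_dep predT (fun b x => cube_cons b x \in A)
  (fun b x => \prod_i bernoulli_pmf p (cube_cons b x i))) /=.
rewrite big_bool !E !big_distrr /=.
congr (_ + _); apply: eq_bigr => x _; rewrite big_ord_recl cube_cons0;
  by congr (_ * _); apply: eq_bigr => i _; rewrite cube_consS.
Qed.

Lemma cube_section_monotone {N} (A : {set cube N.+1}) b :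
  monotone_subset A -> monotone_subset (cube_section A b).
Proof.
move=> mA x y; rewrite !inE => Ax xy; apply: mA Ax _ => i.
by rewrite !ffunE; case: unlift.
Qed.

Lemma cube_section_subset {N} (A : {set cube N.+1}) :
  monotone_subset A -> cube_section A false \subset cube_section A true.
Proof.
move=> mA; apply/fintype.subsetP => x; rewrite !inE => Ax; apply: mA Ax _ => i.
by rewrite !ffunE; case: unlift.
Qed.

(** Karamata's inequality for two points: [b] and [c] lie between [a] and [d] and
    have the same sum, so they are complementary convex combinations of [a] and
    [d], and convexity of [x `^ t] applies to both. *)
Lemma powR_majorization t (a b c d : R) : 1 <= t ->
  0 <= a -> a <= b -> b <= d -> a + d = b + c ->
  b `^ t + c `^ t <= a `^ t + d `^ t.
Proof.
move=> t1 a0 ab bd sum.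
have [ad|ad] := leP d a.
  have -> : b = a by lra.
  by have -> : c = d by lra.
have ad0 : 0 < d - a by lra.
pose l := (d - b) / (d - a).
have l0 : 0 <= l by rewrite divr_ge0 //; lra.
have l1 : l <= 1 by rewrite ler_pdivrMr //; lra.
have inD (z : R) : 0 <= z -> z \in (`[0, +oo[%classic : set R).
  by move=> z0; rewrite inE /= in_itv /= z0.
have conv z w : 0 <= z -> 0 <= w ->
    (l * z + (1 - l) * w) `^ t <= l * z `^ t + (1 - l) * w `^ t.
  move=> z0 w0.
  by have := convex_powR t1 (Itv01 l0 l1) (inD z z0) (inD w w0); rewrite !convRE.
have := conv a d a0 ltac:(lra); have := conv d a ltac:(lra) a0.
have -> : l * a + (1 - l) * d = b.
  by rewrite /l; field; lra.
have -> : l * d + (1 - l) * a = c.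
  have -> : c = a + d - b by lra.
  by rewrite /l; field; lra.
lra.
Qed.

(** The induction step of [mu_powR]. Expanding the left-hand side, the claim is
    [(p * a) `^ t + b `^ t <= (p * b) `^ t + (p * a + (1 - p) * b) `^ t]; the bases
    have the same sum on both sides and are more spread out on the right. *)
Lemma powR_two_point t p (a b : R) : 1 <= t -> 0 <= p <= 1 -> 0 <= b <= a ->
  p `^ t * a `^ t + (1 - p `^ t) * b `^ t <= (p * a + (1 - p) * b) `^ t.
Proof.
move=> t1 /andP[p0 p1] /andP[b0 ba].
have pb : p * b <= b by rewrite ler_piMl.
have bc : b <= p * a + (1 - p) * b by nra.
have := @powR_majorization t (p * b) b (p * a) _ t1 (mulr_ge0 p0 b0) pb bc.
rewrite (powRM _ p0 b0) (powRM _ p0 (le_trans b0 ba)) => /(_ ltac:(ring)).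
lra.
Qed.

(** Equality holds for the sets of [x] equal to 1 on given coordinates. For [t = 2] the inequality says that if the
    coordinatewise minimum of two independent samples is in [A], then so are
    both samples. *)
Lemma mu_powR {N} (A : {set cube N}) p t : monotone_subset A ->
  0 <= p <= 1 -> 1 <= t -> mu (p `^ t) A <= mu p A `^ t.
Proof.
move=> + hp t1; have /andP[p0 p1] := hp.
have hpt : 0 <= p `^ t <= 1.
  rewrite powR_ge0 /=; have -> : 1 = 1 `^ t :> R by rewrite powR1.
  by rewrite ge0_ler_powR ?nnegrE //; lra.
elim: N A => [|N IH] A mA.
  have muA q : mu q A = (#|A|)%:R.
    rewrite /mu (eq_bigr (fun=> 1)) ?sumr_const // => x _.
    by rewrite big_ord0.
  rewrite !muA; have : (#|A| <= 1)%N.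
    by rewrite (leq_trans (max_card _)) // card_ffun card_ord expn0.
  by case: #|A| => [|[|]] // _; rewrite ?powR1 // powR_ge0.
rewrite !mu_cube_section.
apply: le_trans (powR_two_point t1 hp _); last first.
  by rewrite mu_ge0 // mu_subset // cube_section_subset.
apply: lerD; apply: ler_wpM2l; try by lra.
  by apply: IH; exact: cube_section_monotone.
by apply: IH; exact: cube_section_monotone.
Qed.

Definition cube_neg {N} (x : cube N) : cube N := [ffun i => ~~ x i].

Lemma cube_negK {N} : involutive (@cube_neg N).
Proof. by move=> x; apply/ffunP => i; rewrite !ffunE negbK. Qed.

Definition dual_set {N} (A : {set cube N}) : {set cube N} :=
  [set x | cube_neg x \notin A]%SET.

Lemma dual_set_monotone {N} (A : {set cube N}) :
  monotone_subset A -> monotone_subset (dual_set A).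
Proof.
move=> mA x y; rewrite !inE => + xy; apply: contra => Ay.
apply: mA Ay _ => i; rewrite !ffunE; move: (xy i).
by case: (x i); case: (y i).
Qed.

Lemma mu_dual_set {N} (A : {set cube N}) p : mu p (dual_set A) = 1 - mu (1 - p) A.
Proof.
rewrite -mu_setC /mu (reindex_inj (inv_inj (@cube_negK N))) /=.
apply: eq_big => [x|x _]; first by rewrite !inE cube_negK.
apply: eq_bigr => i _; rewrite ffunE /bernoulli_pmf.
by case: (x i) => //=; rewrite subKr.
Qed.

Lemma mu_gt0 {N} (A : {set cube N}) p : monotone_subset A ->
  A <> finset.set0 -> 0 < p <= 1 -> 0 < mu p A.
Proof.
move=> mA /eqP /set0Pn[x Ax] /andP[p0 p1].
have oneA : [ffun => true] \in A.
  by apply: mA Ax _ => i; rewrite ffunE; case: (x i).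
have hp : 0 <= p <= 1 by rewrite ltW.
have : mu p [set [ffun => true] : cube N]%SET <= mu p A.
  by apply: mu_subset; rewrite // finset.sub1set.
apply: lt_le_trans; rewrite /mu big_set1 prodr_gt0 // => i _.
by rewrite ffunE.
Qed.

Lemma mu1 {N} (A : {set cube N}) : monotone_subset A ->
  A <> finset.set0 -> mu 1 A = 1 :> R.
Proof.
move=> mA /eqP /set0Pn[x Ax].
have oneA : [ffun => true] \in A.
  by apply: mA Ax _ => i; rewrite ffunE; case: (x i).
rewrite /mu (bigD1 [ffun => true]) //= big1 => [|i _]; last by rewrite ffunE.
rewrite big1 ?addr0 // => y /andP[_ /eqP y1].
have [i yi] : exists i, y i = false.
  apply: contrapT => h; apply: y1; apply/ffunP => i; rewrite ffunE.
  by apply: contrapT => yi; apply: h; exists i; apply/negbTE/negP.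
by rewrite (bigD1 i) //= yi /bernoulli_pmf subrr mul0r.
Qed.

Lemma dual_set_neq0 {N} (A : {set cube N}) :
  A <> [set: cube N]%SET -> dual_set A <> finset.set0.
Proof.
move=> AT D0; apply: AT; apply/setP => x; rewrite inE.
by have := finset.in_set0 (cube_neg x); rewrite -D0 inE cube_negK => /negbFE.
Qed.

Lemma weight_block {m r : nat} p (x : cube (m * r)) :
  weight p x = \prod_(j < m) weight p (block x j).
Proof.
rewrite /weight (reindex _ (curry_mxvec_bij m r)) /=.
rewrite pair_bigA /=; apply: eq_bigr => -[j i] _ /=.
by rewrite ffunE.
Qed.

(** The indicators of the events that the blocks fall in [A] are independent
    Bernoulli variables of parameter [mu p A]. *)
Lemma mu_otimes {r m : nat} (A : {set cube r}) (B : {set cube m}) p :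
  mu p (otimes A B) = mu (mu p A) B.
Proof.
pose join (f : {ffun 'I_m -> cube r}) : cube (m * r) :=
  [ffun k => let u := enum_val (cast_ord (esym (mxvec_cast m r)) k) in f u.1 u.2].
pose split (x : cube (m * r)) : {ffun 'I_m -> cube r} := [ffun j => block x j].
have joinE f j i : join f (mxvec_index j i) = f j i.
  by rewrite ffunE /mxvec_index cast_ordK enum_rankK.
have joinK : cancel join split.
  by move=> f; apply/ffunP => j; rewrite ffunE; apply/ffunP => i; rewrite ffunE joinE.
have splitK : cancel split join.
  move=> x; apply/ffunP => k; case/mxvec_indexP: k => j i.
  by rewrite joinE !ffunE.
pose q (f : {ffun 'I_m -> cube r}) : cube m := [ffun j => f j \in A].
have bw y j : bernoulli_pmf (mu p A) (y j) =
    \sum_(c : cube r | (c \in A) == y j) weight p c.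
  rewrite /bernoulli_pmf; case: (y j); first by apply: eq_bigl => c; rewrite eqb_id.
  rewrite -mu_setC; apply: eq_bigl => c; rewrite inE; by case: (c \in A).
rewrite /mu (reindex join) /=; last by exists split => f _.
rewrite (eq_bigl (fun f => q f \in B)); last first.
  move=> f; rewrite inE; congr (_ \in B); apply/ffunP => j.
  by rewrite !ffunE; move: (joinK f) => /ffunP/(_ j); rewrite ffunE => ->.
rewrite (partition_big q (mem B)) //=; apply: eq_bigr => y yB.
under [RHS]eq_bigr do rewrite -/(mu p A) bw.
rewrite bigA_distr_big_dep; apply: eq_big => [f|f _].
  apply/andP/familyP => [[_ /eqP <- j]|h]; first by rewrite !ffunE; exact: eqxx.
  have -> : q f = y by apply/ffunP => j; rewrite ffunE; apply/eqP; exact: h.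
  by [].
rewrite -/(weight p (join f)) weight_block; apply: eq_bigr => j _.
by move: (joinK f) => /ffunP/(_ j); rewrite ffunE => ->.
Qed.

End CubeMeasure.

(** * Threshold curves and their levels *)

Section ThresholdCurve.
Context {R : realType}.
Implicit Types (f g : R -> R) (p q t alpha eps : R).

Definition powR_contracting f :=
  forall p t, 0 <= p <= 1 -> 1 <= t -> f (p `^ t) <= f p `^ t.

Definition dual_curve f p := 1 - f (1 - p).

(** The properties of [p |-> mu p A], for [A] monotone and non trivial, from
    which sharpness is derived. They are stable under composition and under
    [dual_curve], so that both products can be handled without returning to
    subsets of cubes. *)
Record threshold_curve f : Prop := ThresholdCurve {
  curve_continuous : continuous f;
  curve0 : f 0 = 0;
  curve1 : f 1 = 1;
  curve_gt0 : forall p, 0 < p <= 1 -> 0 < f p;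
  curve_lt1 : forall p, 0 <= p < 1 -> f p < 1;
  curve_powR : powR_contracting f;
  curve_powR_dual : powR_contracting (dual_curve f) }.

Lemma dual_curveK f : dual_curve (dual_curve f) = f.
Proof. by apply/funext => p; rewrite /dual_curve !subKr. Qed.

Lemma threshold_curve_dual f : threshold_curve f -> threshold_curve (dual_curve f).
Proof.
case=> cf f0 f1 fgt0 flt1 fX fXd; split => //; last by rewrite dual_curveK.
- move=> p; apply: cvgB; first exact: cvg_cst.
  apply: (@continuous_comp _ _ _ (fun p => 1 - p) f); last exact: cf.
  by apply: cvgB; [exact: cvg_cst | exact: cvg_id].
- by rewrite /dual_curve subr0 f1 subrr.
- by rewrite /dual_curve subrr f0 subr0.
- by move=> p hp; rewrite subr_gt0 flt1 //; lra.
- by move=> p hp; rewrite ltrBlDr ltrDl fgt0 //; lra.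
Qed.

Lemma powR_expR p t : 0 < p -> p `^ t = expR (t * ln p).
Proof. by move=> p0; rewrite /powR gt_eqF. Qed.

(** Any point below [p] is a power of [p] with exponent at least 1; this is how
    [powR_contracting] is used to compare values at two given points. *)
Lemma powR_ln_ratio p q : 0 < p < 1 -> 0 < q -> p `^ (ln q / ln p) = q.
Proof.
move=> /[dup] /ln_lt0 lnp /andP[p0 _] q0.
by rewrite powR_expR // mulfVK ?lt_eqF // lnK.
Qed.

Lemma curve_lt f p q : threshold_curve f -> 0 <= q -> q < p -> p <= 1 -> f q < f p.
Proof.
move=> [_ f0 f1 fgt0 flt1 fX _].
rewrite le_eqVlt => /predU1P[<- p0 p1|q0 qp]; first by rewrite f0 fgt0 // p0.
rewrite le_eqVlt => /predU1P[p1|p1]; first by rewrite p1 f1 flt1 //; lra.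
have p01 : 0 < p < 1 by lra.
have t1 : 1 < ln q / ln p.
  by rewrite ltr_ndivlMr ?ln_lt0 // mul1r ltr_ln ?posrE //; lra.
have fp0 : 0 < f p by apply: fgt0; lra.
have fp1 : f p < 1 by apply: flt1; lra.
rewrite -{1}(powR_ln_ratio p01 q0).
apply: le_lt_trans (fX _ _ _ (ltW t1)) _; first lra.
rewrite powR_expR // -{2}(@lnK _ (f p)) ?posrE // ltr_expR.
by rewrite gtr_nMl // ln_lt0 // fp0.
Qed.

Lemma curve_le f p q : threshold_curve f -> 0 <= q -> q <= p -> p <= 1 -> f q <= f p.
Proof.
move=> cf q0; rewrite le_eqVlt => /predU1P[->//|qp] p1.
by apply/ltW/curve_lt.
Qed.

Lemma curve_in01 f p : threshold_curve f -> 0 <= p <= 1 -> 0 <= f p <= 1.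
Proof.
move=> cf /andP[p0 p1].
by rewrite -{1}(curve0 cf) -(curve1 cf) !curve_le.
Qed.

Lemma threshold_curve_comp f g :
  threshold_curve f -> threshold_curve g -> threshold_curve (g \o f).
Proof.
have powR_comp f' g' : threshold_curve f' -> threshold_curve g' ->
    powR_contracting (g' \o f').
  move=> cf cg p t hp t1 /=.
  have pt : 0 <= p `^ t <= 1.
    rewrite powR_ge0 /=; have -> : 1 = 1 `^ t :> R by rewrite powR1.
    by rewrite ge0_ler_powR ?nnegrE //; lra.
  have /andP[fp0 fp1] := curve_in01 cf hp.
  have /andP[fpt0 fpt1] := curve_in01 cf pt.
  apply: le_trans (curve_powR cg _ t1); last by rewrite fp0.
  apply: curve_le => //; first exact: curve_powR.
  have -> : 1 = 1 `^ t :> R by rewrite powR1.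
  by rewrite ge0_ler_powR ?nnegrE //; lra.
move=> cf cg; split.
- move=> p; apply: continuous_comp; exact: curve_continuous.
- by rewrite /= !curve0.
- by rewrite /= !curve1.
- move=> p hp /=; apply: curve_gt0 => //; rewrite curve_gt0 //.
  by have /andP[] := @curve_in01 f p cf ltac:(lra).
- move=> p hp /=; apply: curve_lt1 => //; rewrite curve_lt1 // andbT.
  by have /andP[] := @curve_in01 f p cf ltac:(lra).
- exact: powR_comp.
- have -> : dual_curve (g \o f) = dual_curve g \o dual_curve f.
    by apply/funext => p; rewrite /dual_curve /= subKr.
  by apply: powR_comp; exact: threshold_curve_dual.
Qed.

(** [plevel] for an arbitrary function, so that the level of a product set is the
    level of a composition. *)
Definition level f alpha : R := xget 0 [set p : R | 0 <= p <= 1 /\ f p = alpha].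

Lemma levelE f p : threshold_curve f -> 0 <= p <= 1 -> level f (f p) = p.
Proof.
move=> cf /andP[p0 p1]; apply: xget_unique => [|q [/andP[q0 q1] fqp]].
  by rewrite /= p0.
have [qp|pq|//] := ltgtP q p.
  by have := curve_lt cf q0 qp p1; rewrite fqp ltxx.
by have := curve_lt cf p0 pq q1; rewrite fqp ltxx.
Qed.

Lemma levelP f alpha : threshold_curve f -> 0 < alpha < 1 ->
  0 < level f alpha < 1 /\ f (level f alpha) = alpha.
Proof.
move=> cf /andP[a0 a1].
have [p] : exists2 p, p \in `[0, 1] & f p = alpha.
  apply: IVT => //; first exact/continuous_subspaceT/curve_continuous.
  by rewrite curve0 // curve1 // /Num.min /Num.max ltr01; lra.
rewrite in_itv /= => /[dup] hp /andP[p0 p1] fp.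
rewrite -fp levelE //; split => //.
rewrite !lt_neqAle p0 p1 !andbT; apply/andP; split; apply/eqP => p_eq.
  by move: fp a0; rewrite -p_eq curve0 // => <-; rewrite ltxx.
by move: fp a1; rewrite p_eq curve1 // => <-; rewrite ltxx.
Qed.

Lemma level_le f alpha beta : threshold_curve f ->
  0 < alpha -> alpha <= beta -> beta < 1 -> level f alpha <= level f beta.
Proof.
move=> cf a0 ab b1; rewrite leNgt; apply/negP => lt_levels.
have [/andP[b_gt0 _] fb] := @levelP f beta cf ltac:(lra).
have [/andP[_ a_lt1] fa] := @levelP f alpha cf ltac:(lra).
have := curve_lt cf (ltW b_gt0) lt_levels (ltW a_lt1).
by rewrite fa fb; lra.
Qed.

Lemma level_comp f g alpha : threshold_curve f -> threshold_curve g ->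
  0 < alpha < 1 -> level (g \o f) alpha = level f (level g alpha).
Proof.
move=> cf cg ha; have [hg gE] := levelP cg ha.
have [hf fE] := levelP cf hg.
rewrite -{1}gE -{1}fE -[g _]/((g \o f) _) levelE //; last by lra.
exact: threshold_curve_comp.
Qed.

Lemma level_dual f alpha : threshold_curve f -> 0 < alpha < 1 ->
  level (dual_curve f) alpha = 1 - level f (1 - alpha).
Proof.
move=> cf ha; have [h fE] := @levelP f (1 - alpha) cf ltac:(lra).
set z := level f (1 - alpha) in h fE *.
have aE : dual_curve f (1 - z) = alpha by rewrite /dual_curve subKr fE subKr.
rewrite -{1}aE levelE //; last by lra.
exact: threshold_curve_dual.
Qed.

Lemma bernoulli_ineq q k : 0 <= q <= 1 -> 1 - k%:R * q <= (1 - q) ^+ k.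
Proof.
move=> /andP[q0 q1]; elim: k => [|k IH]; first by rewrite expr0 mul0r subr0.
rewrite exprS; apply: le_trans (ler_wpM2l _ IH); last by lra.
have k0 : 0 <= k%:R :> R by [].
by rewrite -natr1; nra.
Qed.

(** The Bollobas-Thomason bound: if [mu q] of the set is [eps], then the union
    of [k.+1] independent [q]-samples, whose parameter
    [1 - (1 - q) ^+ k.+1] is at most [k.+1 * q], misses the set with probability
    at most [(1 - eps) ^+ k.+1]. Here this is the dual power inequality at the
    point [1 - q]. *)
Lemma level_growth g eps k : threshold_curve g -> 0 < eps < 1 ->
  (1 - eps) ^+ k.+1 <= eps -> level g (1 - eps) <= k.+1%:R * level g eps.
Proof.
move=> cg heps hk.
have [/andP[q0 q1] gq] := levelP cg heps.
have [/andP[z0 z1] gz] := @levelP g (1 - eps) cg ltac:(lra).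
set q := level g eps in q0 q1 gq *; set z := level g _ in z0 z1 gz *.
have := bernoulli_ineq k.+1 (q := q) ltac:(lra).
set s := (1 - q) ^+ k.+1 => bern.
have s0 : 0 <= s by rewrite exprn_ge0 //; lra.
have s1 : s <= 1 by rewrite exprn_ile1 //; lra.
suff : z <= 1 - s by lra.
rewrite leNgt; apply/negP => sz.
have := curve_lt cg (q := 1 - s) (p := z) ltac:(lra) sz ltac:(lra).
have := curve_powR_dual cg (p := 1 - q) (t := k.+1%:R) ltac:(lra) ltac:(by rewrite ler1n).
rewrite /dual_curve powR_mulrn ?subKr; last by lra.
rewrite gq powR_mulrn; last by lra.
by rewrite gz -/s; lra.
Qed.

(** With [d = ln C / - ln (f z)], the power inequality gives
    [f (z `^ (1 + d)) <= f z / C <= f x], so [z `^ (1 + d) <= x], that is,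
    [x / z] is at least [z `^ d], which is close to 1. The point [w] at level 1/2
    controls [d * - ln z], again by the power inequality, now between [w] and
    [z]. *)
Lemma ratio_bound f (x y z w C : R) : threshold_curve f ->
  0 < x -> x <= y -> y <= z -> z <= w -> w < 1 -> f w = 1 / 2 ->
  1 <= C -> f z <= C * f x -> ln C / ln 2 * - ln w <= 1 / 2 ->
  (z - x) / (y * (1 - y)) <= 2 * (ln C / - ln (f z) + ln C / ln 2 * - ln w).
Proof.
move=> cf x0 xy yz zw w1 fw C1 fzx.
have z0 : 0 < z by lra.
have fz0 : 0 < f z by rewrite curve_gt0 //; lra.
have fz2 : f z <= 1 / 2 by rewrite -fw curve_le //; lra.
have lz : ln z < 0 by rewrite ln_lt0 //; lra.
have lw : ln w < 0 by rewrite ln_lt0 //; lra.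
have lv : ln (f z) < 0 by rewrite ln_lt0 //; lra.
have lC : 0 <= ln C by rewrite ln_ge0.
have l2 : 0 < ln 2 :> R by rewrite ln_gt0 //; lra.
set d := ln C / - ln (f z); set s := ln C / ln 2 * - ln w => s2.
have d0 : 0 <= d by rewrite divr_ge0 //; lra.
(* [z = w `^ t] with [t >= 1], hence [ln (f z) <= - t * ln 2]. *)
have dls : d * - ln z <= s.
  have t1 : 1 <= ln z / ln w.
    by rewrite ler_ndivlMr // mul1r ler_ln ?posrE //; lra.
  have := curve_powR cf (p := w) (t := ln z / ln w) ltac:(lra) t1.
  rewrite powR_ln_ratio //; last by lra.
  have half0 : 0 < 1 / 2 :> R by lra.
  rewrite fw -ler_ln ?posrE ?powR_gt0 // ln_powR div1r lnV ?posrE // => lnv.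
  have cross : - ln z * ln 2 <= - ln w * - ln (f z).
    have lw0 : 0 <= - ln w by lra.
    have := ler_wpM2l lw0 lnv.
    have -> : - ln w * (ln z / ln w * - ln 2) = ln z * ln 2 by field; lra.
    lra.
  rewrite /d /s -mulrA -[leRHS]mulrA ler_wpM2l // mulrC [leRHS]mulrC.
  by rewrite ler_pdivrMr; [rewrite mulrAC ler_pdivlMr|lra].
have powR_split p : 0 < p -> p `^ (1 + d) = p * p `^ d.
  by move=> p0; rewrite powRD ?powRr1 ?(gt_eqF p0) ?implybT // ltW.
(* [f z `^ d = C^-1] by the choice of [d]. *)
have xz : z * z `^ d <= x.
  rewrite leNgt; apply/negP => xlt.
  have zd1 : z `^ d <= 1 by rewrite powR_expR // -expR0 ler_expR; nra.
  have := curve_lt cf (ltW x0) xlt ltac:(nra).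
  have := curve_powR cf (p := z) (t := 1 + d) ltac:(lra) ltac:(lra).
  rewrite !powR_split // (powR_expR _ fz0).
  have -> : d * ln (f z) = - ln C by rewrite /d; field; lra.
  rewrite expRN lnK ?posrE; last by lra.
  move=> h1 h2; have := lt_le_trans h2 h1.
  by rewrite ltr_pdivlMr; lra.
have zd : 1 - d * - ln z <= z `^ d.
  by rewrite powR_expR // mulrN opprK expR_ge1Dx.
(* Equivalently [1 / (1 - z) <= 1 + 1 / - ln z]. *)
have lnz : z * - ln z <= 1 - z.
  have := @le_ln1Dx R (z^-1 - 1) ltac:(by rewrite ltrBDr addrC subrr invr_gt0).
  rewrite subrKC lnV ?posrE // => h.
  have := ler_wpM2l (ltW z0) h.
  by rewrite mulrBr mulr1 divff ?gt_eqF.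
have xz2 : z * (1 - d * - ln z) <= x.
  by apply: le_trans xz; rewrite ler_wpM2l // ltW.
rewrite ler_pdivrMr; last by rewrite mulr_gt0 //; lra.
set l := - ln z in dls zd lnz xz2 *.
have l0 : 0 < l by rewrite /l; lra.
have dl0 : 0 <= d * l by rewrite mulr_ge0 // ltW.
(* [x >= z / 2] because [d * - ln z <= s <= 1 / 2]. *)
have yz2 : z / 2 * (1 - z) <= y * (1 - y).
  by apply: ler_pM; nra.
have key : d * l <= (d + d * l) * (1 - z).
  by have := ler_wpM2l d0 lnz; lra.
have step : z * (d * l) <= 2 * (d + s) * (z / 2 * (1 - z)).
  apply: le_trans (ler_wpM2l (ltW z0) key) _.
  have : (d + d * l) * (1 - z) <= (d + s) * (1 - z) by apply: ler_wpM2r; lra.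
  by move=> /(ler_wpM2l (ltW z0)); lra.
have : 2 * (d + s) * (z / 2 * (1 - z)) <= 2 * (d + s) * (y * (1 - y)).
  by apply: ler_wpM2l => //; lra.
lra.
Qed.

(** * Sharpness of compositions *)

Definition sharp_curves (h : nat -> R -> R) := forall eps, 0 < eps < 1 ->
  (level (h n) (1 - eps) - level (h n) eps) /
    (level (h n) (1 / 2) * (1 - level (h n) (1 / 2))) @[n --> \oo] --> (0 : R).

Lemma comp_ratio_bound f g eps C : threshold_curve f -> threshold_curve g ->
  0 < eps <= 1 / 2 -> 1 <= C -> level g (1 - eps) <= C * level g eps ->
  level g (1 - eps) <= 1 / 2 -> ln C / ln 2 * - ln (level f (1 / 2)) <= 1 / 2 ->
  0 <= (level (g \o f) (1 - eps) - level (g \o f) eps) /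
      (level (g \o f) (1 / 2) * (1 - level (g \o f) (1 / 2)))
    <= 2 * (ln C / - ln (level g (1 - eps)) +
            ln C / ln 2 * - ln (level f (1 / 2))).
Proof.
move=> cf cg heps C1 uC v2 s2.
have eps01 : 0 < eps < 1 by lra.
have eps'01 : 0 < 1 - eps < 1 by lra.
have half01 : 0 < (1 / 2 : R) < 1 by lra.
rewrite !(level_comp cf cg) //.
have [hu gu] := levelP cg eps01.
have [hv gv] := levelP cg eps'01.
have uh := @level_le g eps (1 / 2) cg ltac:(lra) ltac:(lra) ltac:(lra).
have hv' := @level_le g (1 / 2) (1 - eps) cg ltac:(lra) ltac:(lra) ltac:(lra).
set u := level g eps in hu gu uC uh *.
set v := level g (1 - eps) in v2 hv gv uC hv' *.
set h := level g (1 / 2) in uh hv' *.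
have [hx fx] := levelP cf hu.
have [hz fz] := levelP cf hv.
have [hw fw] := levelP cf half01.
have xy := @level_le f u h cf ltac:(lra) ltac:(lra) ltac:(lra).
have yz := @level_le f h v cf ltac:(lra) ltac:(lra) ltac:(lra).
have zw := @level_le f v (1 / 2) cf ltac:(lra) ltac:(lra) ltac:(lra).
have := @ratio_bound f _ _ _ _ C cf (proj1 (andP hx)) xy yz zw
  (proj2 (andP hw)) fw C1.
rewrite fx fz => /(_ uC s2) ->; rewrite andbT.
by rewrite divr_ge0 ?mulr_ge0 //; lra.
Qed.

Lemma sharp_curves_comp (f g : nat -> R -> R) :
  (forall n, threshold_curve (f n)) -> (forall n, threshold_curve (g n)) ->
  level (f n) (1 / 2) @[n --> \oo] --> (1 : R) ->
  (forall eps, 0 < eps < 1 -> level (g n) eps @[n --> \oo] --> (0 : R)) ->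
  sharp_curves (fun n => g n \o f n).
Proof.
move=> cf cg f_at1 g_at0.
(* Exchanging [eps] and [1 - eps] changes the sign of the ratio. *)
suff sharp eps : 0 < eps <= 1 / 2 ->
    (level (g n \o f n) (1 - eps) - level (g n \o f n) eps) /
    (level (g n \o f n) (1 / 2) * (1 - level (g n \o f n) (1 / 2)))
      @[n --> \oo] --> (0 : R).
  move=> eps heps; have [le2|lt2] := leP eps (1 / 2).
    by apply: sharp; lra.
  have heps' : 0 < 1 - eps <= 1 / 2 by lra.
  rewrite -oppr0; apply: cvg_trans _ (cvgN (sharp (1 - eps) heps')).
  apply: near_eq_cvg; near=> n => /=.
  by rewrite subKr -mulNr opprB.
move=> heps.
have [k hk] : exists k, (1 - eps) ^+ k.+1 <= eps.
  have := @cvg_expr R (1 - eps) ltac:(by rewrite ger0_norm; lra).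
  move=> /cvgr0Pnorm_lt /(_ eps ltac:(lra)) [k _ /(_ k.+1 (leqnSn k)) /=].
  rewrite ger0_norm => [/ltW|]; first by exists k.
  by rewrite exprn_ge0 //; lra.
pose C : R := k.+1%:R.
have C1 : 1 <= C by rewrite ler1n.
have uC n := level_growth (cg n) (eps := eps) ltac:(lra) hk.
rewrite -/C in uC; clearbody C => {hk}.
have lC : 0 <= ln C by rewrite ln_ge0.
pose s n := ln C / ln 2 * - ln (level (f n) (1 / 2)).
have s0 : s n @[n --> \oo] --> (0 : R).
  rewrite -[X in _ --> X](mulr0 (ln C / ln 2)); apply: cvgMr.
  rewrite -oppr0 -ln1; apply: cvgN.
  by apply: continuous_cvg f_at1; exact: continuous_ln.
have v0 := g_at0 (1 - eps) ltac:(lra).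
have eps'01 : 0 < 1 - eps < 1 by lra.
apply/cvgr0Pnorm_lt => e e0.
have e4 : 0 < e / 4 by rewrite divr_gt0.
have half0 : 0 < 1 / 2 :> R by rewrite divr_gt0.
near=> n.
have v2 : level (g n) (1 - eps) < 1 / 2.
  apply: le_lt_trans (ler_norm _) _; near: n.
  exact: (cvgr0_norm_lt _ v0).
have vM : level (g n) (1 - eps) < expR (- (ln C / (e / 4))).
  apply: le_lt_trans (ler_norm _) _; near: n.
  by apply: (cvgr0_norm_lt _ v0); exact: expR_gt0.
have se : s n < e / 4.
  by apply: le_lt_trans (ler_norm _) _; near: n; apply: (cvgr0_norm_lt _ s0).
have s2 : s n <= 1 / 2.
  apply/ltW/(le_lt_trans (ler_norm _)); near: n.
  exact: (cvgr0_norm_lt _ s0).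
have /andP[ratio0 bound] :=
  comp_ratio_bound (cf n) (cg n) heps C1 (uC n) (ltW v2) s2.
rewrite ger0_norm //; apply: le_lt_trans bound _.
have [/andP[lv0 lv1] _] := levelP (cg n) eps'01.
have lv : ln (level (g n) (1 - eps)) < - (ln C / (e / 4)).
  by rewrite -[ltRHS]expRK ltr_ln ?posrE ?expR_gt0.
rewrite -/(s n); set d := ln C / - _.
have de : d <= e / 4.
  have lnv0 : 0 < - ln (level (g n) (1 - eps)).
    by rewrite oppr_gt0 ln_lt0 // lv0.
  by rewrite /d ler_pdivrMr // mulrC -ler_pdivrMr // lerNr ltW.
have -> : e = 2 * (e / 4 + e / 4) by field.
by rewrite ltr_pM2l // ler_ltD.
Unshelve. all: by end_near.
Qed.

(** Conjugation by [p |-> 1 - p] sends the level [alpha] to 1 minus the level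
    [1 - alpha], which preserves both the width of the threshold window and
    [p * (1 - p)] at level 1/2. *)
Lemma sharp_curves_dual (h : nat -> R -> R) :
  (forall n, threshold_curve (h n)) ->
  sharp_curves (fun n => dual_curve (h n)) -> sharp_curves h.
Proof.
move=> ch sharp eps heps; apply: cvg_trans (sharp eps heps).
apply: near_eq_cvg; near=> n.
have h2 : 1 - 1 / 2 = 1 / 2 :> R by lra.
by rewrite !level_dual ?h2 ?subKr //; lra.
Unshelve. all: by end_near.
Qed.

(** The value at 0, the bound below 1 and the dual power inequality come from the
    value at 1, the positivity and the power inequality of the dual set. *)
Lemma mu_threshold_curve N (A : {set cube N}) :
  nontrivial_subset A -> monotone_subset A -> threshold_curve (fun p : R => mu p A).
Proof.
move=> [A0 AT] mA.
have mD := dual_set_monotone mA; have D0 := dual_set_neq0 AT.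
have dualE p : mu p A = 1 - mu (1 - p) (dual_set A).
  by rewrite mu_dual_set !subKr.
split.
- exact: mu_continuous.
- by rewrite dualE subr0 mu1 // subrr.
- exact: mu1.
- by move=> p; exact: mu_gt0.
- by move=> p hp; rewrite dualE ltrBlDr ltrDl mu_gt0 //; lra.
- by move=> p t; exact: mu_powR.
- move=> p t hp t1.
  by rewrite /dual_curve -!mu_dual_set; exact: mu_powR.
Qed.

End ThresholdCurve.

(** * Products of properties located at 1 and at 0 *)

Unset Implicit Arguments.

Theorem proposition5p1 (R : realType) (r m : nat -> nat)
    (r_gt0 : forall n, (0 < r n)%N) (m_gt0 : forall n, (0 < m n)%N)
    (r_incr : {homo r : i j / (i <= j)%N})
    (m_incr : {homo m : i j / (i <= j)%N})
    (A : forall n, {set cube (r n)}) (B : forall n, {set cube (m n)})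
    (hA : nontrivial_monotone_property A)
    (hB : nontrivial_monotone_property B)
    (A_at1 : forall eps : R, 0 < eps < 1 ->
      plevel (A n) eps @[n --> \oo] --> (1 : R))
    (B_at0 : forall eps : R, 0 < eps < 1 ->
      plevel (B n) eps @[n --> \oo] --> (0 : R)) :
  sharp_threshold R (fun n => otimes (A n) (B n)) /\
  sharp_threshold R (fun n => otimes (B n) (A n)).
Proof.
pose f n (p : R) := mu p (A n); pose g n (p : R) := mu p (B n).
have cf n : threshold_curve (f n).
  by have [ntA mA] := hA n; exact: mu_threshold_curve.
have cg n : threshold_curve (g n).
  by have [ntB mB] := hB n; exact: mu_threshold_curve.
have sharpE N (H : forall n, {set cube (N n)}) (h : nat -> R -> R) :
    (forall n p, mu p (H n) = h n p) -> sharp_curves h -> sharp_threshold R H.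
  move=> hE sharp; change (sharp_curves (fun n (p : R) => mu p (H n))).
  suff -> : (fun n (p : R) => mu p (H n)) = h by [].
  by apply/funext => n; apply/funext => p.
split.
  apply: (sharpE _ _ (fun n => g n \o f n)) => [n p|]; first exact: mu_otimes.
  by apply: sharp_curves_comp => //; apply: A_at1; lra.
apply: (sharpE _ _ (fun n => f n \o g n)) => [n p|]; first exact: mu_otimes.
apply: sharp_curves_dual => [n|]; first exact: threshold_curve_comp.
have dualE n : dual_curve (f n \o g n) = dual_curve (f n) \o dual_curve (g n).
  by apply/funext => p; rewrite /dual_curve /= subKr.
rewrite (funext dualE).
apply: sharp_curves_comp => [n|n||eps heps]; try exact: threshold_curve_dual.
  have -> : (fun n => level (dual_curve (g n)) (1 / 2)) =
      (fun n => 1 - level (g n) (1 - 1 / 2)).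
    by apply/funext => n; rewrite level_dual //; lra.
  rewrite -[X in _ --> X](subr0 1); apply: cvgB; first exact: cvg_cst.
  by apply: B_at0; lra.
have -> : (fun n => level (dual_curve (f n)) eps) =
    (fun n => 1 - level (f n) (1 - eps)).
  by apply/funext => n; rewrite level_dual.
rewrite -[X in _ --> X](subrr 1); apply: cvgB; first exact: cvg_cst.
by apply: A_at1; lra.
Qed.
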